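(* Let $\mathcal{C}$ be a balanced cycle in an arbitrary weighted oriented graph $D$ such that $\mathcal{C}$ has exactly one chord, say $e$. Let $I_{\mathcal{C}}=(f_{\mathbf{c}})$ for some primitive binomial $f_{\mathbf{c}}\in I_{\mathcal{C}}$. Then $f_{\mathbf{c}}$ is indispensable (as an element of $I_D$) if and only if there are no balanced cycles $\mathcal{C}_1,\mathcal{C}_2$ in $D$ sharing the edge $e$ such that $E(\mathcal{C})=(E(\mathcal{C}_1)\cup E(\mathcal{C}_2))\setminus\{e\}$.
   Context: A weighted oriented graph $D=(V(D),E(D),\mathbf{w})$ has a finite simple underlying graph (no loops, no multiple edges) with $V(D)=\{x_1,\dots,x_p\}$; each edge is an ordered pair $(x_i,x_j)$ oriented from its tail $x_i$ to its head $x_j$; $\mathbf{w}:V(D)\to\mathbb{N}=\{1,2,\dots\}$ is a weight function, $w_i=\mathbf{w}(x_i)$. Let $K$ be a field. The toric ideal $I_D\subset K[e:e\in E(D)]$ is the kernel of the $K$-algebra homomorphism $K[e:e\in E(D)]\to K[x_1,\dots,x_p]$ sending the variable $e=(x_i,x_j)$ to $x_ix_j^{w_j}$. The incidence matrix $A(D)$ has rows indexed by vertices and columns by edges; the entry at (vertex $x_i$, edge $e$) is $1$ if $x_i$ is the tail of $e$, $w_i$ if $x_i$ is the head of $e$, and $0$ otherwise. Subgraphs (in particular cycles, which are cycles of the underlying undirected graph) carry the inherited orientation and weights, and the toric ideal of a subgraph is regarded inside $K[e:e\in E(D)]$. A cycle $\mathcal{C}$ is balanced if $\det A(\mathcal{C})=0$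 and unbalanced otherwise. For a balanced cycle $\mathcal{C}$ the ideal $I_{\mathcal{C}}$ is principal, generated by a primitive binomial $f_{\mathbf{c}}$ (unique up to sign). A binomial $\mathbf{e}^{\mathbf{u}}-\mathbf{e}^{\mathbf{v}}$ in a toric ideal is primitive if there is no other nonzero binomial $\mathbf{e}^{\mathbf{u}'}-\mathbf{e}^{\mathbf{v}'}$ in the ideal with $\mathbf{e}^{\mathbf{u}'}\mid\mathbf{e}^{\mathbf{u}}$ and $\mathbf{e}^{\mathbf{v}'}\mid\mathbf{e}^{\mathbf{v}}$. A binomial $f\in I_D$ is indispensable if $f$ or $-f$ belongs to every minimal binomial generating set of $I_D$. A chord of a cycle $\mathcal{C}$ in $D$ is an edge of $D$ not in $E(\mathcal{C})$ whose two end vertices lie in $V(\mathcal{C})$. Two cycles share an edge $e$ means that they intersect exactly in $e$ and its two end vertices. *)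

(* Defs.v *)
From HB Require Import structures.
From mathcomp Require Import all_boot all_order all_algebra.
From mathcomp Require Import mpoly.

Set Implicit Arguments.
Unset Strict Implicit.
Unset Printing Implicit Defensive.

Import GRing.Theory.
Local Open Scope ring_scope.

(* Vertices are 'I_p and edges are 'I_m; since the underlying graph is simple,
   an edge is determined by its unordered pair of ends. *)
Record wograph (p m : nat) := WOGraph {
  tail : 'I_m -> 'I_p;
  head : 'I_m -> 'I_p;
  weight : 'I_p -> nat;
  weight_gt0 : forall x, (0 < weight x)%N;
  no_loop : forall e, tail e != head e;
  no_multi_edge : forall e e',
    [set tail e; head e] = [set tail e'; head e'] -> e = e'
}.

Section Graph.
Variables (p m : nat) (D : wograph p m).
Implicit Types (C : {set 'I_m}) (e : 'I_m) (x y : 'I_p).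

Definition ends e : {set 'I_p} := [set tail D e; head D e].

Definition adj x y : bool := [exists e, ends e == [set x; y]].

(* A subgraph without isolated vertices is given by its edge set. *)
Definition verts C : {set 'I_p} := \bigcup_(e in C) ends e.

(* E(C) consists of the edges {s_i, s_(i+1)} (indices modulo size s). *)
Definition is_cycle C : Prop :=
  exists s : seq 'I_p,
    [/\ (2 < size s)%N, uniq s, cycle adj s &
        C = [set e | [exists x, (x \in s) && (ends e == [set x; next s x])]]].

Definition incidence : 'M[int]_(p, m) :=
  \matrix_(x, e) (if x == tail D e then 1
                  else if x == head D e then (weight D x)%:Z
                  else 0).

(* A(C): only the rows in V(C) and the columns in E(C) are kept. *)
Definition sub_incidence C : 'M[int]_(#|verts C|, #|C|) :=
  mxsub (fun i => enum_val i) (fun j => enum_val j) incidence.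

(* A cycle has as many vertices as edges; the cast makes A(C) square. *)
Definition balanced_cycle C : Prop :=
  is_cycle C /\
  exists eqVE : #|verts C| = #|C|,
    \det (castmx (eqVE, erefl #|C|) (sub_incidence C)) = 0.

Definition chord C e : Prop := e \notin C /\ ends e \subset verts C.

Definition share_edge C1 C2 e : Prop :=
  C1 :&: C2 = [set e] /\ verts C1 :&: verts C2 = ends e.

End Graph.

Section ToricIdeal.
Variables (K : fieldType) (p m : nat) (D : wograph p m).

Definition toric_map (f : {mpoly K[m]}) : {mpoly K[p]} :=
  f \mPo [tuple 'X_(tail D e) * 'X_(head D e) ^+ weight D (head D e) | e < m].

Definition toric_ideal (f : {mpoly K[m]}) : Prop := toric_map f = 0.

(* The subring K[e : e \in C] of K[e : e \in E(D)]. *)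
Definition edge_subring (C : {set 'I_m}) (f : {mpoly K[m]}) : Prop :=
  forall u, u \in msupp f -> forall e, e \notin C -> u e = 0%N.

(* I_C as a subset of K[e : e \in E(D)]; it is an ideal of edge_subring C. *)
Definition sub_toric_ideal (C : {set 'I_m}) (f : {mpoly K[m]}) : Prop :=
  edge_subring C f /\ toric_map f = 0.

(* I_C = (f), as ideals of the ring K[e : e \in C]. *)
Definition sub_toric_ideal_principal (C : {set 'I_m}) (f : {mpoly K[m]}) :=
  forall g : {mpoly K[m]},
    sub_toric_ideal C g <-> exists2 h, edge_subring C h & g = h * f.

End ToricIdeal.

Section Binomials.
Variables (K : fieldType) (m : nat).
Implicit Types (f g : {mpoly K[m]}) (I G H : {mpoly K[m]} -> Prop).
Implicit Types u v : 'X_{1..m}.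

Definition binomial_of u v : {mpoly K[m]} := 'X_[u] - 'X_[v].

Definition is_binomial f : Prop := exists u v, u != v /\ f = binomial_of u v.

Definition primitive I f : Prop :=
  exists u v,
    [/\ u != v, f = binomial_of u v, I f &
        forall u' v', u' != v' -> I (binomial_of u' v') ->
          (u' <= u)%MM -> (v' <= v)%MM -> u' = u /\ v' = v].

Definition ideal_gen G f : Prop :=
  exists2 s : seq ({mpoly K[m]} * {mpoly K[m]}),
    (forall q, q \in s -> G q.2) & f = \sum_(q <- s) q.1 * q.2.

Definition generates G I : Prop := forall f, ideal_gen G f <-> I f.

(* Minimality is with respect to inclusion of generating sets. *)
Definition minimal_binomial_generating_set I G : Prop :=
  [/\ forall g, G g -> is_binomial g,
      generates G I &
      forall H, (forall g, H g -> G g) -> generates H I ->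
        forall g, G g -> H g].

Definition indispensable I f : Prop :=
  [/\ is_binomial f, I f &
      forall G, minimal_binomial_generating_set I G -> G f \/ G (- f)].

End Binomials.

(* Main.v *)
From Stdlib Require Import ClassicalEpsilon FunctionalExtensionality PropExtensionality.
From Stdlib Require Import Relations.
Require Import Defs.
From mathcomp Require Import all_boot all_order all_algebra.
From mathcomp Require Import mpoly.
From mathcomp Require Import zify ring.

(* The fiber of a monomial X^u is the set of X^t with A(D) t = A(D) u.  Write
   f_c = X^u - X^v.  If u and v are the only elements of their fiber, then, their
   supports being disjoint, the coefficient of X^u in an expansion of f_c over
   binomials of I_D shows that one of these binomials is f_c or -f_c.  If u and v
   are joined by a chain of fiber elements in which neighbours have a common
   variable, then some minimal binomial generating set avoids f_c and -f_c.

   A fiber element t that does not use the chord e lies on the line through u and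
   v, hence is u or v by primitivity.  If t uses e, then t - u is a kernel vector of
   A(D) on C and e with nonzero e-entry.  Along each of the two arcs of C cut out
   by e, such a vector is proportional to u - v, because two consecutive edges
   determine each other at their common vertex.  So a combination with u - v
   vanishes on one arc, and both cycles formed by e and an arc are balanced.
   Conversely a kernel vector on one of these cycles can be scaled to agree with
   u - v on its arc; adding it to v gives, up to exchanging u and v, the fiber
   element equal to u on that arc, to v on the other arc and positive at e.  It
   has variables in common with both u and v because the entries of u - v
   alternate in sign along C. *)

(* [head] and [tail] are the ends of an edge, not the list functions. *)
Import Defs.

Set Implicit Arguments.
Unset Strict Implicit.
Unset Printing Implicit Defensive.

(** * Indispensable binomials *)

Section Ideals.
Import GRing.Theory.
Local Open Scope ring_scope.

Variables (K : fieldType) (m : nat).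
Implicit Types (f g h : {mpoly K[m]}) (G : {mpoly K[m]} -> Prop).

Lemma ideal_gen0 G : ideal_gen G 0.
Proof. by exists [::]; rewrite ?big_nil. Qed.

Lemma ideal_gen_mem G g : G g -> ideal_gen G g.
Proof.
move=> Gg; exists [:: (1, g)]; last by rewrite big_seq1 mul1r.
by move=> q; rewrite inE => /eqP ->.
Qed.

Lemma ideal_genD G f g : ideal_gen G f -> ideal_gen G g -> ideal_gen G (f + g).
Proof.
move=> [s sG ->] [t tG ->]; exists (s ++ t); last by rewrite big_cat.
by move=> q; rewrite mem_cat => /orP[/sG|/tG].
Qed.

Lemma ideal_genM G h f : ideal_gen G f -> ideal_gen G (h * f).
Proof.
move=> [s sG ->]; exists [seq (h * q.1, q.2) | q <- s].
  by move=> _ /mapP[q qs ->]; exact: (sG q).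
by rewrite big_map mulr_sumr; apply: eq_bigr => q _; rewrite mulrA.
Qed.

Lemma ideal_genN G f : ideal_gen G f -> ideal_gen G (- f).
Proof. by rewrite -mulN1r; apply: ideal_genM. Qed.

Lemma ideal_genZ G k f : ideal_gen G f -> ideal_gen G (k *: f).
Proof. by rewrite -mul_mpolyC; apply: ideal_genM. Qed.

Lemma mcoeffMX_neq0 f u v :
  (f * 'X_[u])@_v != 0 -> exists w, v = (u + w)%MM.
Proof.
by rewrite -mcoeff_msupp (perm_mem (msuppMX _ _)) => /mapP[w _ ->]; exists w.
Qed.

End Ideals.

(** * Fibers of the toric map and their components under common variables *)

Section Fibers.
Import GRing.Theory.
Local Open Scope ring_scope.

Variables (K : fieldType) (p m : nat) (D : wograph p m).
Implicit Types (u v w a b c : 'X_{1..m}).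

(** The entry of A(D), kept in [nat] so that it can be used in exponents. *)
Definition inc (x : 'I_p) (f : 'I_m) : nat :=
  if x == tail D f then 1 else if x == head D f then weight D x else 0.

(** The product A(D) u, which is the exponent of the image of X^u; a fiber is a level set of
    [vdeg]. *)
Definition vdeg u : 'X_{1..p} := [multinom (\sum_f u f * inc x f)%N | x < p].

Lemma vdegE u x : vdeg u x = (\sum_f u f * inc x f)%N.
Proof. by rewrite mnmE. Qed.

Lemma vdegD u v : vdeg (u + v) = (vdeg u + vdeg v)%MM.
Proof.
apply/mnmP => x; rewrite mnmDE !vdegE -big_split; apply: eq_bigr => f _.
by rewrite mnmDE mulnDl.
Qed.

Lemma toric_mapX u : toric_map D 'X_[u] = 'X_[vdeg u] :> {mpoly K[p]}.
Proof.
rewrite /toric_map comp_mpolyX.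
under eq_bigr => f _ do rewrite tnth_mktuple mpolyXn -mpolyXD.
rewrite mprodXnE; congr 'X_[_]; apply/mnmP => x.
rewrite vdegE mnm_sumE; apply: eq_bigr => f _.
rewrite mulmnE mnmDE mulmnE !mnm1E /inc mulnC (eq_sym x) (eq_sym x).
have := no_loop D f.
case: (tail D f =P x) => [-> /negbTE|_ _]; first by rewrite eq_sym => ->.
by case: eqP => [->|]; rewrite ?add0n ?mul1n.
Qed.

Lemma toric_map_binomial u v :
  toric_map D (binomial_of K u v) = 'X_[vdeg u] - 'X_[vdeg v].
Proof. by rewrite -!toric_mapX /toric_map -comp_mpolyB. Qed.

Lemma mpolyX_inj n : injective (fun u : 'X_{1..n} => 'X_[u] : {mpoly K[n]}).
Proof.
move=> u v /(congr1 (mcoeff u)); rewrite !mcoeffX eqxx.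
by case: eqP => [//|_] /eqP; rewrite oner_eq0.
Qed.

Lemma toric_binomialP u v :
  toric_ideal D (binomial_of K u v) <-> vdeg u = vdeg v.
Proof.
rewrite /toric_ideal toric_map_binomial; split=> [/subr0_eq|->].
  exact: mpolyX_inj.
exact: subrr.
Qed.

(** Coefficients are compared at u, then at a. The exchanged case arises only in characteristic 2,
    where 0 - 1 = 1; hence the form of [delta1]. *)
Lemma binomial_inj u v a b : u != v -> binomial_of K u v = binomial_of K a b ->
  (u = a /\ v = b) \/ (u = b /\ v = a).
Proof.
rewrite /binomial_of => nuv E; case: (a =P u) => [au|/eqP nau].
  by left; split=> //; move: E; rewrite au => /addrI/oppr_inj/mpolyX_inj.
have delta1 (b1 b2 : bool) : (b1%:R - b2%:R = 1 :> K) -> ~~ b1 -> b2.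
  by case: b1 b2 => [] [] //; rewrite subrr => /eqP; rewrite eq_sym oner_eq0.
have bu : b == u.
  apply: (delta1 (a == u)) nau; rewrite -!mcoeffX -mcoeffB -E.
  by rewrite mcoeffB !mcoeffX eqxx eq_sym (negbTE nuv) subr0.
have va : v == a.
  apply: (delta1 (u == a)); last by rewrite eq_sym.
  rewrite -!mcoeffX -mcoeffB E mcoeffB !mcoeffX eqxx (eqP bu) eq_sym.
  by rewrite (negbTE nau) subr0.
by right; rewrite (eqP bu) (eqP va).
Qed.

Lemma mcoeff_binomial u v w :
  (binomial_of K u v)@_w = (u == w)%:R - (v == w)%:R.
Proof. by rewrite mcoeffB !mcoeffX. Qed.

(** A common variable splits off from X^a - X^b and leaves a binomial of the toric ideal of smaller
    degree. *)
Definition overlap a b : Prop := vdeg a = vdeg b /\ exists2 i, (0 < a i)%N & (0 < b i)%N.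

Definition conn : relation 'X_{1..m} := clos_refl_sym_trans _ overlap.

Lemma conn_vdeg a b : conn a b -> vdeg a = vdeg b.
Proof.
elim=> {a b} [a b []|//|a b _ -> //|a b c _ -> _ ->] //.
Qed.

Lemma conn_sym a b : conn a b -> conn b a.
Proof. exact: rst_sym. Qed.

Lemma conn_trans b a c : conn a b -> conn b c -> conn a c.
Proof. exact: rst_trans. Qed.

Lemma conn_translate w a b :
  vdeg a = vdeg b -> w != 0%MM -> conn (w + a)%MM (w + b)%MM.
Proof.
move=> ab w0; apply: rst_step; split; first by rewrite !vdegD ab.
have [i wi] : exists i, w i != 0%N.
  apply/existsP; apply: contra_neqT w0 => /existsPn w0.
  by apply/mnmP => i; rewrite mnm0E; apply/eqP; rewrite -[_ == _]negbK.
by exists i; rewrite mnmDE ltn_addr ?lt0n.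
Qed.

Lemma unique_fiber_indispensable u v :
    u != v -> vdeg u = vdeg v -> (forall i, u i = 0%N \/ v i = 0%N) ->
    (forall t, vdeg t = vdeg u -> t = u \/ t = v) ->
  indispensable (toric_ideal D) (binomial_of K u v).
Proof.
move=> nuv duv disj fib; split; [by exists u, v | exact/toric_binomialP |].
move=> G [Gbin Ggen _].
have [s sG fE] : ideal_gen G (binomial_of K u v) by apply/Ggen/toric_binomialP.
have [/hasP[q qs qu]|/hasPn nos] := boolP (has (fun q => (q.1 * q.2)@_u != 0) s); last first.
  have /eqP : (binomial_of K u v)@_u = 0.
    rewrite fE raddf_sum big_seq big1 // => q qs.
    by apply/eqP; rewrite -[_ == _]negbK nos.
  by rewrite mcoeff_binomial eqxx [v == u]eq_sym (negbTE nuv) subr0 oner_eq0.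
have Gq := sG _ qs; have [a [b [nab qab]]] := Gbin _ Gq.
have dab : vdeg a = vdeg b.
  by apply/toric_binomialP; rewrite -qab; apply/Ggen/ideal_gen_mem.
suff key a' b' : a' != b' -> vdeg a' = vdeg b' ->
    (q.1 * 'X_[a'])@_u != 0 -> a' = u /\ b' = v.
  move: qu; rewrite qab mulrBr mcoeffB.
  have [->|au _] := eqVneq ((q.1 * 'X_[a])@_u) 0; last first.
    by left; move: Gq; have [<- <-] := key a b nab dab au; rewrite qab.
  rewrite sub0r oppr_eq0 => bu; right; move: Gq.
  have nba : b != a by rewrite eq_sym.
  have [<- <-] := key b a nba (esym dab) bu.
  by rewrite opprB qab.
move=> nab' dab' /mcoeffMX_neq0[w uE].
have ddu : vdeg (b' + w)%MM = vdeg u by rewrite uE !vdegD dab'.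
(* Replacing a' by b' stays in the fiber, so b' + w is u or v. In the second case w divides both X^u
   and X^v, so w = 0 by disjointness. *)
have [E|E] := fib _ ddu.
  by case/eqP: nab'; move: E; rewrite uE => /addIm.
have w0 : w = 0%MM.
  apply/mnmP => i; have := disj i; rewrite uE -E !mnmDE mnm0E.
  by case=> /eqP; rewrite addn_eq0 => /andP[_ /eqP].
by move: uE E; rewrite w0 !addm0.
Qed.

(** * A minimal binomial generating set read off from the components of the fibers *)

Lemma mdeg_le_vdeg a : (mdeg a <= mdeg (vdeg a))%N.
Proof.
rewrite !mdegE; under [leqRHS]eq_bigr do rewrite vdegE.
rewrite exchange_big leq_sum //= => f _.
(* The entry of A(D) at the tail is 1, so the tail alone accounts for [a f]. *)
by rewrite (bigD1 (tail D f)) //= /inc eqxx muln1 leq_addr.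
Qed.

(* A representative of the fiber of [a], and one of its connected component. *)
Definition frep a : 'X_{1..m} := epsilon (inhabits 0%MM) (fun b => vdeg b = vdeg a).
Definition crep a : 'X_{1..m} := epsilon (inhabits 0%MM) (conn a).

Lemma frepP a : vdeg (frep a) = vdeg a.
Proof. by apply: (@epsilon_spec _ _ (fun b => vdeg b = vdeg a)); exists a. Qed.

Lemma frep_eq a b : vdeg a = vdeg b -> frep a = frep b.
Proof. by rewrite /frep => ->. Qed.

Lemma crepP a : conn a (crep a).
Proof. by apply: (@epsilon_spec _ _ (conn a)); exists a; apply: rst_refl. Qed.

Lemma crep_eq a b : conn a b -> crep a = crep b.
Proof.
move=> ab; rewrite /crep; congr epsilon; apply: functional_extensionality => c.
by apply: propositional_extensionality; split; apply: conn_trans => //; apply: conn_sym.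
Qed.

(** In each fiber the components form a star around that of [frep], with one generator for each
    other component. As a tree, it has no redundant edge. *)
Definition min_gens (g : {mpoly K[m]}) : Prop :=
  exists2 a, ~ conn (frep a) a & g = binomial_of K (frep a) (crep a).

Lemma frep_crep_neq a : ~ conn (frep a) a -> frep a != crep a.
Proof. by move=> na; apply/eqP => E; apply: na; rewrite E; apply/conn_sym/crepP. Qed.

Lemma binomialD b a c :
  binomial_of K a c = binomial_of K a b + binomial_of K b c.
Proof. by rewrite /binomial_of addrA subrK. Qed.

Lemma binomialN a b : binomial_of K b a = - binomial_of K a b.
Proof. by rewrite /binomial_of opprB. Qed.

(** Induction on the degree of the image. Inside a component a common variable splits off and lowers
    this degree; distinct components are joined through [frep]. *)
Lemma min_gens_binomial a b :
  vdeg a = vdeg b -> ideal_gen min_gens (binomial_of K a b).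
Proof.
have [n] := ubnP (mdeg (vdeg a)); elim: n a b => // n IH a b leab dab.
have gen_conn c c' : conn c c' -> vdeg c = vdeg a ->
    ideal_gen min_gens (binomial_of K c c').
  elim=> {c c'} [c c' [dcc' [i ci ci']] dc|c _|c c' cc' Hc dc|c1 c2 c3 c12 H12 _ H23 dc].
  - have /submK Ec : (U_(i) <= c)%MM by rewrite lep1mP -lt0n.
    have /submK Ec' : (U_(i) <= c')%MM by rewrite lep1mP -lt0n.
    rewrite -Ec -Ec' /binomial_of !mpolyXD -mulrBl mulrC.
    apply/ideal_genM/IH.
      move: leab; rewrite -dc -{1}Ec vdegD mdegD ltnS.
      apply: leq_trans; rewrite -addn1 leq_add2l.
      by apply: leq_trans (mdeg_le_vdeg _); rewrite mdeg1.
    by move: dcc'; rewrite -{1}Ec -{1}Ec' !vdegD => /addIm.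
  - by rewrite /binomial_of subrr; apply: ideal_gen0.
  - by rewrite binomialN; apply/ideal_genN/Hc; rewrite (conn_vdeg cc').
  - rewrite (binomialD c2); apply: ideal_genD; first exact: H12.
    by apply: H23; rewrite -(conn_vdeg c12).
have gen_frep c : vdeg c = vdeg a -> ideal_gen min_gens (binomial_of K (frep c) c).
  move=> dc; have [nc|cc] := classic (~ conn (frep c) c).
    rewrite (binomialD (crep c)); apply: ideal_genD.
      by apply: ideal_gen_mem; exists c.
    by apply: gen_conn; [apply/conn_sym/crepP | rewrite -(conn_vdeg (crepP c))].
  by apply: gen_conn; [apply: NNPP | rewrite frepP].
rewrite (binomialD (frep a)); apply: ideal_genD.
  by rewrite binomialN; apply/ideal_genN/gen_frep.
by rewrite (frep_eq dab); apply: gen_frep.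
Qed.

(** At a representative b, the coefficient is the sum of those of [f] over the fiber, which is the
    coefficient of [toric_map D f] at [vdeg b]. *)
Lemma sum_frep_eq0 f : toric_ideal D f ->
  \sum_(a <- msupp f) f@_a *: 'X_[frep a] = 0 :> {mpoly K[m]}.
Proof.
move=> f0; apply/mpolyP => b; rewrite raddf_sum mcoeff0 /=.
have [bb|nb] := eqVneq (frep b) b; last first.
  rewrite big1 // => a _; rewrite mcoeffZ mcoeffX.
  case: eqP => [E|_]; last by rewrite mulr0.
  by case/eqP: nb; rewrite -{2}E; apply: frep_eq; rewrite -E frepP.
have /(congr1 (mcoeff (vdeg b))) := f0.
rewrite /toric_map comp_mpolyEX raddf_sum mcoeff0 /= => E; rewrite -[RHS]E.
apply: eq_bigr => a _; rewrite -[_ \mPo _]/(toric_map D _) toric_mapX.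
rewrite !mcoeffZ !mcoeffX; congr (_ * _%:R); congr nat_of_bool.
by apply/eqP/eqP => [<-|/frep_eq ->]; rewrite ?frepP.
Qed.

Lemma min_gens_generate : generates min_gens (@toric_ideal K p m D).
Proof.
move=> f; split=> [[s sG ->]|f0].
  rewrite /toric_ideal /toric_map raddf_sum /= big_seq big1 // => q qs.
  have [a _ qE] := sG q qs.
  have q0 : toric_ideal D q.2.
    by rewrite qE; apply/toric_binomialP; rewrite frepP; apply/conn_vdeg/crepP.
  by rewrite rmorphM /= [X in _ * X]q0 mulr0.
have -> : f = \sum_(a <- msupp f) f@_a *: binomial_of K a (frep a).
  rewrite (eq_bigr (fun a => f@_a *: 'X_[a] - f@_a *: 'X_[frep a])).
    by rewrite sumrB sum_frep_eq0 // subr0 -mpolyE.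
  by move=> a _; rewrite -scalerBr.
apply: (big_ind (ideal_gen min_gens)) => [||a _]; first exact: ideal_gen0.
  exact: ideal_genD.
by apply/ideal_genZ/min_gens_binomial; rewrite frepP.
Qed.

(** If [g] were missing from [H], the linear form [phi] attached to the component of its [a] would
    vanish on the ideal generated by [H], but not on [g]. *)
Lemma min_gens_minimal (H : {mpoly K[m]} -> Prop) :
    (forall g, H g -> min_gens g) -> generates H (@toric_ideal K p m D) ->
  forall g, min_gens g -> H g.
Proof.
move=> HG Hgen g Gg; apply: NNPP => nHg; have [a na gE] := Gg.
pose B w : bool := excluded_middle_informative (conn a w).
have BP w : reflect (conn a w) (B w).
  by rewrite /B; case: excluded_middle_informative => ?; constructor.
(* [phi] sums the coefficients over the component of [a]; the degree bound,
   valid on the whole fiber, only serves to make the sum finite. *)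
pose phi f : K := \sum_(w : 'X_{1..m < (mdeg (vdeg a)).+1} | B w) f@_w.
have phi0 : phi 0 = 0 by rewrite /phi big1 // => w _; rewrite mcoeff0.
have phiD : {morph phi : f1 f2 / f1 + f2}.
  by move=> f1 f2; rewrite /phi -big_split; apply: eq_bigr => w _; rewrite mcoeffD.
have phiZ k f : phi (k *: f) = k * phi f.
  by rewrite /phi mulr_sumr; apply: eq_bigr => w _; rewrite mcoeffZ.
have phiB f1 f2 : phi (f1 - f2) = phi f1 - phi f2.
  by rewrite phiD -scaleN1r phiZ mulN1r.
have phiX w : phi 'X_[w] = (B w)%:R.
  rewrite /phi; case: (BP w) => [aw|naw].
    have ltw : (mdeg w < (mdeg (vdeg a)).+1)%N.
      by rewrite ltnS (conn_vdeg aw) mdeg_le_vdeg.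
    rewrite (bigD1 (BMultinom ltw)) /=; last exact/BP.
    rewrite mcoeffX eqxx big1 ?addr0 // => w' /andP[_ nw].
    by move: nw; rewrite mcoeffX -val_eqE eq_sym /= => /negbTE ->.
  rewrite big1 // => w' /BP aw'; rewrite mcoeffX.
  by case: eqP aw' naw => [-> //|].
have phiG h g' : H g' -> phi (h * g') = 0.
  move=> Hg'; have [a' na' gE'] := HG _ Hg'.
  rewrite [h]mpolyE mulr_suml (big_morph phi phiD phi0) big1 //= => s _.
  rewrite -scalerAl phiZ gE' mulrBr phiB -!mpolyXD !phiX.
  suff -> : B (s + frep a')%MM = B (s + crep a')%MM by rewrite subrr mulr0.
  have da' : vdeg (frep a') = vdeg (crep a').
    by rewrite frepP; apply/conn_vdeg/crepP.
  (* A nontrivial multiplier puts both monomials in one component. For the multiplier 1, having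
     [frep a'] in the component of [a] contradicts [na], and having [crep a'] there makes [g'] equal
     to [g]. *)
  have [s0|s0] := eqVneq s 0%MM; last first.
    have C := conn_translate da' s0.
    by apply/BP/BP => /conn_trans; apply => //; apply: conn_sym.
  rewrite s0 !add0m; apply/BP/BP => [aa|aa]; exfalso.
    by apply: na; apply: conn_sym; rewrite (frep_eq (etrans (conn_vdeg aa) (frepP a'))).
  apply: nHg; rewrite gE.
  have {}aa : conn a a' by apply: conn_trans aa (conn_sym (crepP _)).
  by rewrite (frep_eq (conn_vdeg aa)) (crep_eq aa) -gE'.
have /Hgen[s sH sE] : toric_ideal D g by apply/min_gens_generate/ideal_gen_mem.
have : phi g = 0.
  by rewrite sE (big_morph phi phiD phi0) big_seq big1 // => q /sH; apply: phiG.
rewrite gE phiB !phiX.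
have -> : B (frep a) = false by apply/BP => /conn_sym.
have -> : B (crep a) by apply/BP/crepP.
by move/eqP; rewrite sub0r oppr_eq0 oner_eq0.
Qed.

(** Every element of [min_gens] joins two distinct components, so neither sign of the binomial
    occurs there. *)
Lemma conn_not_indispensable u v :
  conn u v -> ~ indispensable (toric_ideal D) (binomial_of K u v).
Proof.
move=> uv [_ _ /(_ min_gens)[]].
- split; [|exact: min_gens_generate|exact: min_gens_minimal].
  move=> _ [a na ->]; exists (frep a), (crep a); split=> //.
  exact: frep_crep_neq.
- move=> [a na] /esym/(binomial_inj (frep_crep_neq na)).
  case=> -[E1 E2]; apply: na; rewrite E1; apply: conn_sym.
    by apply: conn_trans (crepP a) _; rewrite E2; apply: conn_sym.
  by apply: conn_trans (crepP a) _; rewrite E2.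
- rewrite -binomialN.
  move=> [a na] /esym/(binomial_inj (frep_crep_neq na)).
  case=> -[E1 E2]; apply: na; rewrite E1; apply: conn_sym.
    by apply: conn_trans (crepP a) _; rewrite E2.
  by apply: conn_trans (crepP a) _; rewrite E2; apply: conn_sym.
Qed.

End Fibers.

(** * Parametrized cycles *)

Section Cycles.

Variables (p m : nat) (D : wograph p m).
Implicit Types (C : {set 'I_m}) (e f : 'I_m) (x : nat -> 'I_p) (g : nat -> 'I_m).

Lemma eqmodS d i j : (i.+1 == j.+1 %[mod d]) = (i == j %[mod d]).
Proof. by rewrite -(addn1 i) -(addn1 j) eqn_modDr. Qed.

(* [x] and [g] are n-periodic, so that no index has to be reduced modulo n. *)
Record cyc_param C n x g : Prop := CycParam {
  cyc_size : 2 < n;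
  cyc_vert : forall i j, x i = x j <-> i = j %[mod n];
  cyc_ends : forall i, ends D (g i) = [set x i; x i.+1];
  cyc_edge : forall f, f \in C <-> exists i, f = g i
}.

Lemma is_cycle_param C : is_cycle D C -> exists n x g, cyc_param C n x g.
Proof.
case=> [[|y s]]; first by case.
move=> [s_size s_uniq s_cyc CE].
set n := (size s).+1; pose x i := nth y (y :: s) (i %% n).
have ltn i : i %% n < n by rewrite ltn_mod.
have next_x i : next (y :: s) (x i) = x i.+1.
  have ix : index (x i) (y :: s) = i %% n by rewrite index_uniq.
  rewrite next_nth mem_nth // ix.
  rewrite [RHS]/x; have [lt|ge] := ltnP (i %% n) (size s).
    by rewrite -addn1 -modnDml addn1 [_.+1 %% _]modn_small.
  have E : i %% n = size s by apply/eqP; rewrite eqn_leq ge -ltnS ltn.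
  by rewrite E nth_default // -addn1 -modnDml E addn1 modnn.
have adj_x i : adj D (x i) (x i.+1).
  by rewrite -next_x; apply: next_cycle => //; apply: mem_nth.
pose g i := xchoose (existsP (adj_x i)).
have endsg i : ends D (g i) = [set x i; x i.+1].
  by apply/eqP/(xchooseP (existsP (adj_x i))).
exists n, x, g; split=> //.
- move=> i j; split=> [/eqP|]; last by rewrite /x => ->.
  by rewrite /x nth_uniq // => /eqP.
- move=> f; rewrite CE inE; split=> [/existsP[z /andP[zs /eqP fz]]|[i ->]].
    exists (index z (y :: s)); apply: (@no_multi_edge _ _ D).
    rewrite -/(ends D f) -/(ends D (g _)) endsg -next_x.
    by rewrite /x modn_small ?nth_index // -[n]/(size (y :: s)) index_mem.
  by apply/existsP; exists (x i); rewrite mem_nth //= endsg -next_x eqxx.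
Qed.

Section Param.
Variables (C : {set 'I_m}) (n : nat) (x : nat -> 'I_p) (g : nat -> 'I_m).
Hypothesis P : cyc_param C n x g.

Let n_gt0 : 0 < n. Proof. by case: P => /ltnW/ltnW. Qed.

Lemma ends_inj f f' : ends D f = ends D f' -> f = f'.
Proof. exact: no_multi_edge. Qed.

Lemma cyc_mem i : g i \in C.
Proof. by apply/(cyc_edge P); exists i. Qed.

Lemma cyc_edge_eq i j : g i = g j <-> i = j %[mod n].
Proof.
have [n2 xP gP _] := P.
split=> [E|E]; last first.
  apply: ends_inj; rewrite !gP; congr [set _; _]; apply/xP => //.
  by apply/eqP; rewrite eqmodS; apply/eqP.
have : [set x i; x i.+1] = [set x j; x j.+1] by rewrite -!gP E.
move=> S; have := set21 (x i) (x i.+1); have := set22 (x i) (x i.+1).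
rewrite S !inE => /orP[]/eqP/xP E1 /orP[]/eqP/xP E2 //.
(* The ends match in reversed order, so n divides 2, against n > 2. *)
- have /eqP : i + 2 = i %[mod n].
    by rewrite addn2 -(addn1 i.+1) -modnDml E1 modnDml addn1 E2.
  by rewrite -{2}[i]addn0 eqn_modDl mod0n modn_small.
- by apply/eqP; rewrite -eqmodS; apply/eqP.
Qed.

Lemma cyc_edge_neq i : g i != g i.+1.
Proof.
apply/eqP => /cyc_edge_eq/eqP; rewrite -{1}[i]addn0 -addn1 eqn_modDl mod0n.
by rewrite modn_small // ltnW ?(cyc_size P).
Qed.

(** Indexing the vertex by [i.+1] avoids a subtraction modulo n for its preceding edge. *)
Lemma cyc_incident i f : f \in C -> x i.+1 \in ends D f -> f = g i \/ f = g i.+1.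
Proof.
move=> /(cyc_edge P)[j ->]; rewrite (cyc_ends P) !inE => /orP[]/eqP/(cyc_vert P) E.
  by right; apply/cyc_edge_eq.
left; apply/cyc_edge_eq/esym/eqP.
by rewrite -eqmodS; apply/eqP.
Qed.

Lemma cyc_edgeP f : reflect (exists i : 'I_n, f = g i) (f \in C).
Proof.
apply: (iffP idP) => [/(cyc_edge P)[i ->]|[i ->]]; last exact: cyc_mem.
exists (Ordinal (ltn_pmod i n_gt0)); apply/cyc_edge_eq => /=.
by rewrite modn_mod.
Qed.

Lemma cyc_vertsP y : reflect (exists i : 'I_n, y = x i) (y \in verts D C).
Proof.
apply: (iffP bigcupP) => [[f /(cyc_edge P)[i ->]]|[i ->]]; last first.
  by exists (g i); rewrite ?cyc_mem // (cyc_ends P) set21.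
rewrite (cyc_ends P) !inE => yx.
have [j ->] : exists j, y = x j by case/orP: yx => /eqP ->; [exists i|exists i.+1].
exists (Ordinal (ltn_pmod j n_gt0)); apply/(cyc_vert P) => /=.
by rewrite modn_mod.
Qed.

Lemma cyc_card_edges : #|C| = n.
Proof.
have -> : C = [set g i | i : 'I_n].
  apply/setP => f; apply/cyc_edgeP/imsetP => [[i ->]|[i _ ->]]; by exists i.
rewrite card_imset ?card_ord // => i j /cyc_edge_eq.
by rewrite !modn_small // => /val_inj.
Qed.

Lemma cyc_card_verts : #|verts D C| = n.
Proof.
have -> : verts D C = [set x i | i : 'I_n].
  apply/setP => f; apply/cyc_vertsP/imsetP => [[i ->]|[i _ ->]]; by exists i.
rewrite card_imset ?card_ord // => i j /(cyc_vert P).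
by rewrite !modn_small // => /val_inj.
Qed.

Lemma cyc_shift r : cyc_param C n (fun i => x (r + i)) (fun i => g (r + i)).
Proof.
have [n2 xP gP CP] := P; split=> // [i j|i|f].
- split=> [/xP/eqP|/eqP E]; first by rewrite eqn_modDl => /eqP.
  by apply/xP/eqP; rewrite eqn_modDl.
- by rewrite gP addnS.
- split=> [/CP[i ->]|[i ->]]; last exact: cyc_mem.
  (* Adding [r * n] first makes the truncated subtraction exact. *)
  exists (i + r * n - r); apply/cyc_edge_eq; rewrite subnKC.
    by rewrite addnC modnMDl.
  by rewrite (leq_trans (leq_pmulr r n_gt0)) ?leq_addl.
Qed.

Lemma cyc_param_is_cycle : is_cycle D C.
Proof.
have [n2 xP gP CP] := P.
have xs i : x i \in mkseq x n.
  apply/mapP; exists (i %% n); first by rewrite mem_iota ltn_mod.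
  by apply/xP; rewrite modn_mod.
have s_uniq : uniq (mkseq x n).
  apply/mkseq_uniqP => i j; rewrite !inE => lti ltj /xP.
  by rewrite !modn_small.
have sE : mkseq x n = x 0 :: mkseq (fun i => x i.+1) n.-1.
  case: (n) n_gt0 => // k _; rewrite /mkseq /= (iotaDl 1) -map_comp.
  by congr cons; apply: eq_map.
have next_x i : next (mkseq x n) (x i) = x i.+1.
  have -> : x i = x (i %% n) by apply/xP; rewrite modn_mod.
  have lti : i %% n < n by rewrite ltn_mod.
  rewrite next_nth xs -{2}(nth_mkseq (x 0) x lti) index_uniq ?size_mkseq //.
  rewrite sE; have [lt|ge] := ltnP (i %% n) n.-1.
    by rewrite nth_mkseq //; apply/xP/eqP; rewrite eqmodS modn_mod.
  rewrite nth_default ?size_mkseq //; apply/xP.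
  have E : (i %% n).+1 = n by lia.
  by rewrite mod0n -(addn1 i) -modnDml addn1 E modnn.
exists (mkseq x n); split; rewrite ?size_mkseq //.
- rewrite sE /=; apply/(pathP (x 0)) => i; rewrite size_rcons size_mkseq => lti.
  have {}lti : i < n by lia.
  rewrite -rcons_cons -sE nth_rcons size_mkseq lti nth_mkseq //.
  have -> : rcons (mkseq (fun i => x i.+1) n.-1) (x 0) = mkseq (fun i => x i.+1) n.
    have {2}-> : n = n.-1.+1 by lia.
    rewrite mkseqS; congr rcons; apply/xP; rewrite prednK // modnn mod0n //.
  by rewrite nth_mkseq //; apply/existsP; exists (g i); rewrite gP.
- apply/setP => f; rewrite inE; apply/cyc_edgeP/existsP.
    move=> [i ->]; exists (x i); rewrite xs next_x gP eqxx //.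
  move=> [_ /andP[/mapP[i i_n ->]]]; rewrite next_x => /eqP E.
  move: i_n; rewrite mem_iota /= => i_n; exists (Ordinal i_n).
  by apply: ends_inj; rewrite E gP.
Qed.

(** The arc from x_0 to x_k is closed by e, which receives the index k; all indices are now read
    modulo k + 1, the length of the new cycle. *)
Lemma cyc_chord k e (k_gt1 : 1 < k) (k_lt : k < n) :
    ends D e = [set x 0; x k] -> e \notin C ->
  cyc_param (e |: [set g i | i : 'I_k]) k.+1 (fun i => x (i %% k.+1))
    (fun i => if i %% k.+1 == k then e else g (i %% k.+1)).
Proof.
have [n2 xP gP CP] := P; move=> eE eC.
have ltk i : i %% k.+1 <= k by rewrite -ltnS ltn_mod.
split=> // [i j|i|f].
- split=> [/xP|-> //]; rewrite !(@modn_small _ n) //.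
    exact: leq_ltn_trans (ltk _) k_lt.
  exact: leq_ltn_trans (ltk _) k_lt.
- have dvdE : (k.+1 %| i.+1) = (i %% k.+1 == k).
    rewrite /dvdn -(addn1 i) -modnDml addn1; have [->|nk] := eqVneq (i %% k.+1) k.
      by rewrite modnn eqxx.
    by rewrite modn_small // ltnS ltn_neqAle nk ltk.
  rewrite modnS dvdE; case: eqP => [->|_]; last exact: gP.
  by rewrite eE setUC.
- rewrite !inE; split=> [/orP[/eqP ->|/imsetP[i _ ->]]|[i ->]].
  + by exists k; rewrite modn_small // eqxx.
  + by exists i; rewrite modn_small ?ltn_eqF // ltnS ltnW.
  + have [_|nk] := eqVneq (i %% k.+1) k; rewrite ?eqxx //.
    have lt : i %% k.+1 < k by rewrite ltn_neqAle nk ltk.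
    by apply/orP; right; apply/imsetP; exists (Ordinal lt).
Qed.

End Param.

(** A rotation puts the tail of e at x_0. Its head is neither x_0, as there are no loops, nor a
    neighbour of x_0 on the cycle, as the graph is simple and e lies outside [C]. *)
Lemma chord_param C e : is_cycle D C -> chord D C e ->
  exists n x g k, [/\ cyc_param C n x g, ends D e = [set x 0; x k], 1 < k & k.+1 < n].
Proof.
move=> /is_cycle_param[n [x [g P]]] [eC eV].
have n_gt0 : 0 < n by case: P => /ltnW/ltnW.
have /(subsetP eV)/(cyc_vertsP P)[a aE] : tail D e \in ends D e by rewrite set21.
have /(subsetP eV)/(cyc_vertsP P)[b bE] : head D e \in ends D e by rewrite set22.
pose k := (b + n - a) %% n.
have kE : a + k = b %[mod n].
  by rewrite modnDmr subnKC ?modnDr // -[leqLHS]add0n leq_add // ltnW.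
have P' := cyc_shift P a; have [n2 xP gP CP] := P'.
have eE : ends D e = [set x (a + 0); x (a + k)].
  rewrite addn0 /ends aE bE; congr [set _; _]; exact/(cyc_vert P).
have kn : k < n by rewrite ltn_mod.
exists n, (fun i => x (a + i)), (fun i => g (a + i)), k; split=> //.
  case: k eE {kE kn} => [|[|k]] // eE.
    have S y : y \in ends D e -> y = x a by rewrite eE !inE addn0 orbb => /eqP.
    by case/eqP: (no_loop D e); rewrite (S (tail D e)) ?set21 // (S (head D e)) ?set22.
  case/negP: eC; apply/CP; exists 0; apply: ends_inj; by rewrite eE gP.
rewrite ltn_neqAle kn andbT; apply/eqP => E.
case/negP: eC; apply/CP; exists k; apply: ends_inj; rewrite eE gP E setUC.
by congr [set _; _]; apply/xP; rewrite modnn mod0n.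
Qed.

End Cycles.

(** * Kernel vectors of the incidence matrix *)

Section Kernel.
Import Order.TTheory GRing.Theory Num.Theory.
Local Open Scope ring_scope.

Variables (p m : nat) (D : wograph p m).
Implicit Types (C : {set 'I_m}) (e f : 'I_m) (d : 'I_m -> rat) (u v : 'X_{1..m}).

(** Rational entries allow kernel vectors to be rescaled until they agree on a chosen edge. *)
Definition kernel d : Prop := forall x, \sum_f d f * (inc D x f)%:R = 0.

Definition supported d C : Prop := forall f, d f != 0 -> f \in C.

Lemma kernelD d d' : kernel d -> kernel d' -> kernel (fun f => d f + d' f).
Proof.
move=> kd kd' x; under eq_bigr do rewrite mulrDl.
by rewrite big_split /= kd kd' addr0.
Qed.

Lemma kernelZ k d : kernel d -> kernel (fun f => k * d f).
Proof.
move=> kd x; under eq_bigr do rewrite -mulrA.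
by rewrite -mulr_sumr kd mulr0.
Qed.

Lemma eq_kernel d d' : d =1 d' -> kernel d -> kernel d'.
Proof. by move=> E kd x; rewrite -[RHS](kd x); apply: eq_bigr => f _; rewrite E. Qed.

Definition diffv u v f : rat := (u f)%:R - (v f)%:R.

Lemma supported_diffv u v C : (forall f, f \notin C -> u f = 0%N) ->
  (forall f, f \notin C -> v f = 0%N) -> supported (diffv u v) C.
Proof. by move=> uC vC f; apply: contraR => fC; rewrite /diffv uC ?vC ?subrr. Qed.

Lemma vdeg_kernel u v : vdeg D u = vdeg D v <-> kernel (diffv u v).
Proof.
have S x : \sum_f diffv u v f * (inc D x f)%:R =
    (vdeg D u x)%:R - (vdeg D v x)%:R :> rat.
  rewrite !vdegE !natr_sum -sumrB; apply: eq_bigr => f _.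
  by rewrite !natrM mulrBl.
split=> [E x|k]; first by rewrite S E subrr.
apply/mnmP => x; apply/eqP; rewrite -(eqr_nat rat) -subr_eq0 -S.
exact/eqP.
Qed.

Lemma inc_gt0 x f : (0 < inc D x f)%N = (x \in ends D f).
Proof.
rewrite /inc !inE; case: eqP => [_|_]; first by [].
by case: eqP => // _; rewrite (weight_gt0 D).
Qed.

Lemma inc_eq0 x f : x \notin ends D f -> inc D x f = 0%N.
Proof. by rewrite -inc_gt0 lt0n negbK => /eqP. Qed.

Lemma kernel_pair d x f f' : f != f' ->
    (forall h, d h != 0 -> x \in ends D h -> h = f \/ h = f') -> kernel d ->
  d f * (inc D x f)%:R + d f' * (inc D x f')%:R = 0.
Proof.
move=> nff' inc2 kd; rewrite -[RHS](kd x) (bigD1 f) //= (bigD1 f') //= 1?eq_sym //.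
rewrite big1 ?addr0 // => h /andP[hf hf'].
have [->|d0] := eqVneq (d h) 0; first by rewrite mul0r.
have [xh|xh] := boolP (x \in ends D h); last by rewrite inc_eq0 // mulr0.
by case: (inc2 h d0 xh) => E; rewrite E eqxx in hf hf'.
Qed.

(** A zero determinant amounts to a nonzero rational kernel vector on the edges of [C]. Vertices off
    [C] add no equation, since the columns of [C] vanish there. *)
Lemma balanced_kernel C : balanced_cycle D C <->
  is_cycle D C /\ exists d, [/\ kernel d, supported d C & exists f, d f != 0].
Proof.
have sub_inc i j : sub_incidence D C i j = (inc D (enum_val i) (enum_val j))%:Z.
  by rewrite !mxE /inc; case: eqP => // _; case: eqP.
have cast q (q0 : q = #|C|) (A : 'M[int]_(q, #|C|)) :
    \det (castmx (q0, erefl #|C|) A) = 0 <->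
    exists w : 'I_#|C| -> rat, (exists j, w j != 0) /\
      forall i, \sum_j w j * (A i j)%:~R = 0.
  case: _ / q0 A => A; rewrite castmx_id.
  (* [det0P] speaks of row vectors acting from the left, hence the transpose. *)
  have -> : \det A = 0 <-> \det (map_mx (intr : int -> rat) A)^T = 0.
    rewrite det_tr det_map_mx; split=> [->//|/eqP].
    by rewrite intr_eq0 => /eqP.
  split=> [/eqP/det0P[w w0 wA]|[w [[j wj] wA]]].
    exists (w 0); split=> [|i].
      by have /rV0Pn := w0.
    by have /rowP/(_ i) := wA; rewrite !mxE => E; rewrite -[RHS]E; apply: eq_bigr => j _; rewrite !mxE.
  apply/eqP/det0P; exists (\row_j w j).
    by apply/rV0Pn; exists j; rewrite mxE.
  by apply/rowP => i; rewrite !mxE -[RHS](wA i); apply: eq_bigr => h _; rewrite !mxE.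
split=> [[cycC [E /cast[w [[j wj] kw]]]]|[cycC [d [kd sd [f df]]]]]; split=> //.
(* This extends [w] by zero: the sum has one term on [C] and none elsewhere. *)
- pose d f := \sum_(i | enum_val i == f) w i.
  exists d; split.
  + move=> x; under eq_bigr do rewrite mulr_suml big_mkcond.
    rewrite exchange_big /= (eq_bigr (fun i => w i * (inc D x (enum_val i))%:R)).
      have [xC|xC] := boolP (x \in verts D C).
        rewrite -[RHS](kw (enum_rank_in xC x)); apply: eq_bigr => i _.
        by rewrite sub_inc enum_rankK_in.
      rewrite big1 // => i _; rewrite inc_eq0 ?mulr0 //.
      by apply: contra xC => xi; apply/bigcupP; exists (enum_val i); rewrite ?enum_valP.
    move=> i _; rewrite (bigD1 (enum_val i)) //= eqxx big1 ?addr0 // => f.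
    by rewrite eq_sym => /negbTE ->.
  + move=> f; apply: contraR => fC; rewrite /d big1 // => i /eqP E'.
    by rewrite -E' enum_valP in fC.
  + exists (enum_val j); rewrite /d (bigD1 j) //= big1 ?addr0 // => i /andP[/eqP/enum_val_inj ->].
    by rewrite eqxx.
- have [n [x [g P]]] := is_cycle_param cycC.
  have E : #|verts D C| = #|C| by rewrite (cyc_card_edges P) (cyc_card_verts P).
  exists E; apply/cast; exists (fun j => d (enum_val j)); split.
    have Cf := sd f df.
    by exists (enum_rank_in Cf f); rewrite enum_rankK_in.
  move=> i; rewrite -[RHS](kd (enum_val i)).
  under eq_bigr do rewrite sub_inc.
  rewrite -(big_enum_val (fun f => d f * (inc D (enum_val i) f)%:R)).
  rewrite [RHS](bigID (mem C)) /= [X in _ = _ + X]big1 ?addr0 // => h hC.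
  by have [->|/sd] := eqVneq (d h) 0; rewrite ?mul0r // (negbTE hC).
Qed.

(** * Propagation of kernel vectors along a cycle *)

Section CycleKernel.
Variables (C : {set 'I_m}) (n : nat) (x : nat -> 'I_p) (g : nat -> 'I_m).
Hypothesis P : cyc_param D C n x g.

Lemma cyc_inc_gt0 i : (0 < inc D (x i.+1) (g i))%N && (0 < inc D (x i.+1) (g i.+1))%N.
Proof. by rewrite !inc_gt0 !(cyc_ends P) set22 set21. Qed.

(* At the vertex x_(i+1), the vector [d] only sees the edges g_i and g_(i+1). *)
Definition local_support d i : Prop :=
  forall f, d f != 0 -> x i.+1 \in ends D f -> f \in C.

Lemma cyc_kernel_step d i : local_support d i -> kernel d ->
  d (g i) * (inc D (x i.+1) (g i))%:R
    + d (g i.+1) * (inc D (x i.+1) (g i.+1))%:R = 0.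
Proof.
move=> loc; apply: kernel_pair (cyc_edge_neq P i) _ => f f0 xf.
by apply: (cyc_incident P) => //; apply: loc.
Qed.

Lemma cyc_kernel_step0 d i :
  local_support d i -> kernel d -> d (g i) = 0 -> d (g i.+1) = 0.
Proof.
move=> loc kd E; have := cyc_kernel_step loc kd.
have /andP[_] := cyc_inc_gt0 i; rewrite -(ltr0n rat) => /lt0r_neq0/negbTE i0.
by rewrite E mul0r add0r => /eqP; rewrite mulf_eq0 i0 orbF => /eqP.
Qed.

(** Both incidence entries in the two-term relation are positive, so the two values of [d] have
    opposite signs. *)
Lemma cyc_kernel_alternate d i :
    local_support d i -> kernel d -> d (g i) != 0 ->
  (0 < d (g i) /\ d (g i.+1) < 0) \/ (d (g i) < 0 /\ 0 < d (g i.+1)).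
Proof.
move=> loc kd d0; have := cyc_kernel_step loc kd.
have /andP[] := cyc_inc_gt0 i; rewrite -!(ltr0n rat) => a0 b0 /eqP.
rewrite addrC addr_eq0 => /eqP E.
case: (ltgtP (d (g i)) 0) d0 => // di _; [right|left]; split=> //.
  by rewrite -(pmulr_lgt0 _ b0) E oppr_gt0 pmulr_llt0.
by rewrite -(pmulr_llt0 _ b0) E oppr_lt0 pmulr_lgt0.
Qed.

Lemma cyc_kernel_range0 d lo hi :
    (forall i, (lo <= i < hi)%N -> local_support d i) -> kernel d ->
    d (g lo) = 0 ->
  forall i, (lo <= i <= hi)%N -> d (g i) = 0.
Proof.
move=> loc kd dlo; elim=> [|i IH] /andP[loi ihi].
  by move: loi dlo; rewrite leqn0 => /eqP ->.
move: loi; rewrite leq_eqVlt => /orP[/eqP <- //|loi].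
by apply: cyc_kernel_step0 => //; [apply: loc | apply: IH]; rewrite ?(ltnW ihi) ?ihi -ltnS loi.
Qed.

Lemma cyc_kernel_eq0 d f : kernel d -> supported d C -> f \in C ->
  d f = 0 -> forall f', d f' = 0.
Proof.
move=> kd sd /(cyc_edge P)[i ->] di f'.
have [->|/sd] := eqVneq (d f') 0; first by [].
have n_gt0 : (0 < n)%N by case: P => /ltnW/ltnW.
(* The edge g_j is given an index at least i, so that the zero at g_i propagates forward to it. *)
move=> /(cyc_edge P)[j ->]; have -> : g j = g (i * n + j).
  by apply/(cyc_edge_eq P); rewrite modnMDl.
apply: (@cyc_kernel_range0 d i (i * n + j)) => //.
  by move=> h _ f0 /sd.
by rewrite leqnn andbT (leq_trans (leq_pmulr i n_gt0)) ?leq_addr.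
Qed.

Section Binomial.
Variables u v : 'X_{1..m}.
Hypotheses (uv : u != v) (duv : vdeg D u = vdeg D v)
  (uC : forall f, f \notin C -> u f = 0%N) (vC : forall f, f \notin C -> v f = 0%N).

Local Notation c := (diffv u v).

Let kc : kernel c. Proof. exact/vdeg_kernel. Qed.

Let sc : supported c C. Proof. exact: supported_diffv. Qed.

Lemma cyc_binomial_neq0 i : c (g i) != 0.
Proof.
apply: contra_neq uv => ci; apply/mnmP => f; apply/eqP.
rewrite -(eqr_nat rat) -subr_eq0; apply/eqP.
exact: cyc_kernel_eq0 kc sc (cyc_mem P i) ci f.
Qed.

Lemma cyc_binomial_alternate i :
  (v (g i) < u (g i) /\ u (g i.+1) < v (g i.+1))%N
  \/ (u (g i) < v (g i) /\ v (g i.+1) < u (g i.+1))%N.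
Proof.
have loc : local_support c i by move=> f /sc.
have := cyc_kernel_alternate loc kc (cyc_binomial_neq0 i).
by rewrite /diffv !subr_gt0 !subr_lt0 !ltr_nat.
Qed.

(* [t - u] is a multiple q of [u - v]; nonnegativity of [t] gives -1 <= q <= 0, and
   the binomial of [u - t] and [t - u] contradicts primitivity unless q is 0 or -1. *)
Lemma primitive_fiber t :
    (forall u' v', u' != v' -> vdeg D u' = vdeg D v' ->
      (u' <= u)%MM -> (v' <= v)%MM -> u' = u /\ v' = v) ->
    vdeg D t = vdeg D u -> (forall f, f \notin C -> t f = 0%N) ->
  (forall f, u f = 0%N \/ v f = 0%N) /\ (t = u \/ t = v).
Proof.
move=> prim dtu tC.
have dsub a b : vdeg D a = vdeg D b -> vdeg D (a - b)%MM = vdeg D (b - a)%MM.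
  move=> ab; have : (a - b + b = b - a + a)%MM.
    by apply/mnmP => f; rewrite !mnmDE !mnmBE; lia.
  by move/(congr1 (vdeg D)); rewrite !vdegD ab => /addIm.
have neq_sub (a b : 'X_{1..m}) : a != b -> (a - b)%MM != (b - a)%MM.
  apply: contra_neq => /mnmP E; apply/mnmP => f.
  by have := E f; rewrite !mnmBE; lia.
(* Cancelling the common factor of X^u and X^v leaves a binomial below them; by primitivity nothing
   was cancelled. *)
have disj f : u f = 0%N \/ v f = 0%N.
  have [| |/mnmP/(_ f) + _] := prim _ _ (neq_sub _ _ uv) (dsub _ _ duv).
  - by apply/mnm_lepP => h; rewrite mnmBE leq_subr.
  - by apply/mnm_lepP => h; rewrite mnmBE leq_subr.
  by rewrite mnmBE; lia.
split=> //; have [->|tu] := eqVneq t u; [by left | right].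
pose q := ((t (g 0))%:R - (u (g 0))%:R) / c (g 0).
have tE f : (t f)%:R = (u f)%:R + q * c f.
  pose w h := ((t h)%:R - (u h)%:R) + - q * c h.
  suff /eqP : w f = 0 by rewrite /w mulNr subr_eq0 subr_eq => /eqP ->; rewrite addrC.
  have c0 := cyc_binomial_neq0 0.
  apply: (cyc_kernel_eq0 _ _ (cyc_mem P 0)).
  - apply: kernelD; last exact: kernelZ.
    exact/vdeg_kernel.
  - move=> h; apply: contraR => hC.
    by rewrite /w /diffv uC // vC // tC // !subrr mulr0 addr0.
  - by rewrite /w /q; field.
have sign : exists f f', (v f < u f)%N /\ (u f' < v f')%N.
  have [[a b]|[b a]] := cyc_binomial_alternate 0.
    by exists (g 0), (g 1).
  by exists (g 1), (g 0).
have [f [f' [vu uv']]] := sign.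
have tge0 h : 0 <= (t h)%:R :> rat by exact: ler0n.
have q_ge : -1 <= q.
  have [E|E] := disj f; first by rewrite E in vu.
  have u0 : 0 < (u f)%:R :> rat by rewrite ltr0n; lia.
  have := tge0 f; rewrite tE /diffv E subr0.
  have -> : (u f)%:R + q * (u f)%:R = (q + 1) * (u f)%:R by ring.
  by rewrite pmulr_lge0 // -[-1 <= q]subr_ge0 opprK.
have q_le : q <= 0.
  have [E|E] := disj f'; last by rewrite E in uv'.
  have v0 : 0 < (v f')%:R :> rat by rewrite ltr0n; lia.
  have := tge0 f'; rewrite tE /diffv E sub0r add0r mulrN -mulNr.
  by rewrite pmulr_lge0 // oppr_ge0.
have t_ge_u h : v h = 0%N -> (t h <= u h)%N.
  move=> E; rewrite -(ler_nat rat) tE /diffv E subr0 gerDl.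
  by rewrite mulr_le0_ge0.
have t_le_v h : u h = 0%N -> (t h <= v h)%N.
  move=> E; rewrite -(ler_nat rat) tE /diffv E add0r sub0r mulrN -mulNr.
  by rewrite ler_piMl // lerNl.
have ut : u != t by rewrite eq_sym.
have [| |/mnmP E /mnmP E'] := prim _ _ (neq_sub _ _ ut) (dsub _ _ (esym dtu)).
- by apply/mnm_lepP => h; rewrite mnmBE leq_subr.
- apply/mnm_lepP => h; rewrite mnmBE.
  by have := t_ge_u h; have := t_le_v h; case: (disj h) => ->; lia.
apply/mnmP => h; have := E h; have := E' h; rewrite !mnmBE.
by have := t_ge_u h; have := t_le_v h; case: (disj h) => ->; lia.
Qed.

End Binomial.

(** * A cycle together with one chord *)

Section Chord.
Variables (e : 'I_m) (k : nat).
Hypotheses (eE : ends D e = [set x 0; x k]) (eC : e \notin C)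
  (k_gt1 : (1 < k)%N) (k_lt : (k.+1 < n)%N).

Lemma chord_interior d i : supported d (e |: C) ->
  i.+1 <> k %[mod n] -> i.+1 <> 0 %[mod n] -> local_support d i.
Proof.
move=> sd ik i0 f /sd; rewrite in_setU1 => /orP[/eqP ->|//].
by rewrite eE !inE => /orP[]/eqP/(cyc_vert P).
Qed.

Lemma edge_kernel_eq0 d : kernel d -> supported d [set e] -> d e = 0.
Proof.
move=> kd sd; have := kd (tail D e); rewrite (bigD1 e) //= big1 ?addr0.
  by rewrite /inc eqxx mulr1.
move=> f fe; have [->|/sd] := eqVneq (d f) 0; first by rewrite mul0r.
by rewrite inE (negbTE fe).
Qed.

Lemma chord_arc1 d : kernel d -> supported d (e |: C) -> d (g 0) = 0 ->
  forall i, (i < k)%N -> d (g i) = 0.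
Proof.
move=> kd sd d0 i ik; apply: (@cyc_kernel_range0 d 0 k.-1) => //; last by lia.
move=> j jk; apply: chord_interior => //.
  by rewrite !modn_small; lia.
by rewrite mod0n modn_small; lia.
Qed.

Lemma chord_arc2 d : kernel d -> supported d (e |: C) -> d (g k) = 0 ->
  forall i, (k <= i < n)%N -> d (g i) = 0.
Proof.
move=> kd sd d0 i ik; apply: (@cyc_kernel_range0 d k n.-1) => //; last by lia.
move=> j jk; apply: chord_interior => //.
  by rewrite !modn_small; lia.
by rewrite mod0n modn_small; lia.
Qed.

(* The two arcs of C are {g_0, .., g_(k-1)} and {g_k, .., g_(n-1)}; the vector
   produced here is supported on the cycle formed by e and the first one. *)
Lemma kernel_split c z :
    kernel c -> supported c C -> c (g 0) != 0 -> c (g k) != 0 ->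
    kernel z -> supported z (e |: C) -> z e != 0 ->
  exists y, [/\ kernel y, supported y (e |: C), y e != 0,
    forall i, (i < k)%N -> y (g i) = c (g i) &
    forall i, (k <= i < n)%N -> y (g i) = 0].
Proof.
move=> kc sc c0 ck kz sz ze.
pose comb r f := z f + - r * c f.
have kcomb r : kernel (comb r) by apply: kernelD => //; apply: kernelZ.
have scomb r : supported (comb r) (e |: C).
  move=> f; apply: contraR => fC; rewrite /comb.
  have /eqP -> : z f == 0 by apply: contraR fC; apply: sz.
  have /eqP -> : c f == 0.
    by apply: contraR fC => /sc; rewrite inE orbC => ->.
  by rewrite mulr0 addr0.
(* On the first arc [z] equals [a] times [c], on the second [b] times [c]. *)
pose a := z (g 0) / c (g 0); pose b := z (g k) / c (g k).
have a0 : comb a (g 0) = 0 by rewrite /comb /a; field.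
have b0 : comb b (g k) = 0 by rewrite /comb /b; field.
have arc1 := chord_arc1 (kcomb a) (scomb a) a0.
have arc2 := chord_arc2 (kcomb b) (scomb b) b0.
have ce : c e = 0 by apply/eqP; apply: contraR eC; apply: sc.
(* If a = b, one combination vanishes on both arcs and is supported on e alone, which forces z e =
   0. *)
have ab : a - b != 0.
  apply: contra_neqN ze => /eqP/subr0_eq ab.
  have -> : z e = comb a e by rewrite /comb ce mulr0 addr0.
  apply: edge_kernel_eq0 => // f /[dup] /scomb; rewrite !inE.
  case/orP=> [-> //|/(cyc_edgeP P)[i ->]].
  have [ik|ik] := ltnP i k; first by rewrite arc1 ?eqxx.
  by rewrite ab arc2 ?eqxx // ik ltn_ord.
(* On the first arc z - b c = (a - b) c, whence the normalization. *)
exists (fun f => (a - b)^-1 * comb b f); split.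
- exact: kernelZ.
- by move=> f; rewrite mulf_eq0 negb_or => /andP[_ /scomb].
- by rewrite mulf_neq0 ?invr_eq0 // /comb ce mulr0 addr0.
- move=> i /arc1; rewrite /comb => /eqP; rewrite addr_eq0 mulNr opprK => /eqP ->.
  by field.
- by move=> i /arc2 ->; rewrite mulr0.
Qed.

(** The vector t = v + y is a fiber element that shares a variable with u on the first arc and with
    v on the second. *)
Lemma kernel_split_conn u v y :
    u != v -> vdeg D u = vdeg D v ->
    (forall f, f \notin C -> u f = 0%N) -> (forall f, f \notin C -> v f = 0%N) ->
    kernel y -> supported y (e |: C) -> 0 < y e ->
    (forall i, (i < k)%N -> y (g i) = diffv u v (g i)) ->
    (forall i, (k <= i < n)%N -> y (g i) = 0) ->
  conn D u v.
Proof.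
move=> uv duv uC vC ky sy ye y1 y2.
have y_arc f : f != e -> y f = 0 \/ y f = diffv u v f.
  move=> fe; have [->|/sy] := eqVneq (y f) 0; first by left.
  rewrite !inE (negbTE fe) => /(cyc_edgeP P)[i ->].
  have [ik|ik] := ltnP i k; first by right; apply: y1.
  by left; apply: y2; rewrite ik ltn_ord.
(* The kernel equation at the tail of e, where e has entry 1, expresses y e through integers. *)
have y_nat : y e \is a Num.nat.
  rewrite natrEint ltW // andbT.
  have := ky (tail D e); rewrite (bigD1 e) //= {1}/inc eqxx mulr1.
  move/eqP; rewrite addr_eq0 => /eqP ->; rewrite rpredN rpred_sum // => f fe.
  rewrite rpredM ?rpred_nat //.
  by case: (y_arc f fe) => ->; rewrite ?rpred0 // rpredB ?rpred_nat.
have /natrP[N yN] := y_nat.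
pose t : 'X_{1..m} := [multinom if f == e then N else if y f == 0%R then v f else u f | f < m].
have tE f : diffv t v f = y f.
  rewrite /diffv mnmE; have [->|fe] := eqVneq f e; first by rewrite vC // subr0 yN.
  have [->|nz] := eqVneq (y f) 0; first by rewrite subrr.
  by case: (y_arc f fe) nz => [->|-> //]; rewrite eqxx.
have dtv : vdeg D t = vdeg D v.
  by apply/vdeg_kernel; apply: eq_kernel ky => f; rewrite tE.
have ge i : g i != e by apply: contraNneq eC => <-; exact: (cyc_mem P).
have t1 i : (i < k)%N -> t (g i) = u (g i).
  by move=> ik; rewrite mnmE (negbTE (ge i)) y1 // (negbTE (cyc_binomial_neq0 uv duv uC vC i)).
have t2 i : (k <= i < n)%N -> t (g i) = v (g i).
  by move=> ik; rewrite mnmE (negbTE (ge i)) y2 // eqxx.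
apply: (@conn_trans _ _ _ t); apply: rst_step; split=> //; first by rewrite dtv.
(* Each arc has at least two edges by the bounds on k. Two consecutive ones carry opposite signs of
   u - v, so u is positive on an edge of the first arc and v on one of the second. *)
- have [[a _]|[_ a]] := cyc_binomial_alternate uv duv uC vC 0.
    by exists (g 0); rewrite ?t1 ?(ltnW k_gt1) // (leq_ltn_trans _ a).
  by exists (g 1); rewrite ?t1 // (leq_ltn_trans _ a).
- have [[_ a]|[a _]] := cyc_binomial_alternate uv duv uC vC k.
    by exists (g k.+1); rewrite ?t2 ?leqnSn ?k_lt // (leq_ltn_trans _ a).
  by exists (g k); rewrite ?t2 ?leqnn ?(ltnW k_lt) // (leq_ltn_trans _ a).
Qed.

Section OffCycleKernel.
Variables (u v : 'X_{1..m}) (z : 'I_m -> rat).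
Hypotheses (uv : u != v) (duv : vdeg D u = vdeg D v)
  (uC : forall f, f \notin C -> u f = 0%N) (vC : forall f, f \notin C -> v f = 0%N)
  (kz : kernel z) (sz : supported z (e |: C)) (ze : z e != 0).

Local Notation c := (diffv u v).

Let split : exists y, [/\ kernel y, supported y (e |: C), y e != 0,
  forall i, (i < k)%N -> y (g i) = c (g i) &
  forall i, (k <= i < n)%N -> y (g i) = 0].
Proof.
apply: kernel_split kz sz ze; first exact/vdeg_kernel.
- exact: supported_diffv.
- exact: cyc_binomial_neq0 uv duv uC vC 0.
- exact: cyc_binomial_neq0 uv duv uC vC k.
Qed.

Lemma off_cycle_kernel_conn : conn D u v.
Proof.
have [y [ky sy ye y1 y2]] := split.
case: (ltgtP (y e) 0) ye => // ye _; last exact: (kernel_split_conn uv duv uC vC) ye y1 y2.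
(* When y e < 0, negating [y] exchanges the roles of u and v. *)
apply: conn_sym; pose y' f := -1 * y f.
apply: (@kernel_split_conn v u y'); rewrite 1?eq_sym //.
- exact: kernelZ.
- by move=> f; rewrite /y' mulf_eq0 negb_or => /andP[_ /sy].
- by rewrite /y' mulN1r oppr_gt0.
- by move=> i ik; rewrite /y' y1 // mulN1r opprB.
- by move=> i ik; rewrite /y' y2 // mulr0.
Qed.

(** The vector [y] lives on e and the first arc, and u - v - y on e and the second; both are
    nonzero. *)
Lemma off_cycle_kernel_balanced : exists C1 C2,
  [/\ balanced_cycle D C1, balanced_cycle D C2,
      share_edge D C1 C2 e & C = (C1 :|: C2) :\ e].
Proof.
have [y [ky sy ye y1 y2]] := split.
have k_lt' : (k < n)%N by apply: ltnW.
have P1 := cyc_chord P k_gt1 k_lt' eE eC.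
have eE2 : ends D e = [set x (k + 0); x (k + (n - k))].
  rewrite eE setUC addn0 subnKC; last exact: ltnW.
  by congr [set _; _]; apply/(cyc_vert P); rewrite modnn mod0n.
have nk1 : (1 < n - k)%N by lia.
have nk2 : (n - k < n)%N by lia.
(* Rotating by k turns the second arc into an initial one, from x_k to x_n = x_0. *)
have P2 := cyc_chord (cyc_shift P k) nk1 nk2 eE2 eC.
set C1 := e |: _ in P1; set C2 := e |: _ in P2.
have C1P f : reflect (f = e \/ exists2 i, (i < k)%N & f = g i) (f \in C1).
  rewrite !inE; apply: (iffP orP) => -[].
  - by move/eqP; left.
  - by case/imsetP => i _ ->; right; exists i.
  - by move->; left.
  - by case=> i ik ->; right; apply/imsetP; exists (Ordinal ik).
have C2P f : reflect (f = e \/ exists2 i, (k <= i < n)%N & f = g i) (f \in C2).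
  rewrite !inE; apply: (iffP orP) => -[].
  - by move/eqP; left.
  - case/imsetP => i _ ->; right; exists (k + i)%N => //.
    by have := ltn_ord i; lia.
  - by move->; left.
  - case=> i ik ->; right; have ik' : (i - k < n - k)%N by lia.
    by apply/imsetP; exists (Ordinal ik') => //=; rewrite subnKC //; case/andP: ik.
have CP f : reflect (exists2 i, (i < n)%N & f = g i) (f \in C).
  by apply: (iffP (cyc_edgeP P f)) => [[i ->]|[i lt ->]]; [exists i | exists (Ordinal lt)].
exists C1, C2; split.
- apply/balanced_kernel; split; first exact: cyc_param_is_cycle P1.
  exists y; split=> //; last by exists e.
  move=> f yf; apply/C1P; have := sy f yf; rewrite !inE => /orP[/eqP|]; first by left.
  case/CP => i ilt E; right; exists i => //; rewrite ltnNge; apply/negP => ki.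
  by move: yf; rewrite E y2 ?eqxx // ki ilt.
- apply/balanced_kernel; split; first exact: cyc_param_is_cycle P2.
  exists (fun f => c f + -1 * y f); split.
  + by apply: kernelD; [exact/vdeg_kernel | exact: kernelZ].
  + move=> f; apply: contraR => /C2P fC2.
    have [fC|fC] := boolP (f \in C).
      case/CP: fC fC2 => i ilt -> fC2; rewrite y1 ?mulN1r ?subrr //.
      by rewrite ltnNge; apply/negP => ki; apply: fC2; right; exists i; rewrite ?ki.
    have -> : c f = 0 by rewrite /diffv uC // vC // subrr.
    have /eqP -> : y f == 0; last by rewrite mulr0 addr0.
    apply: contraR fC => /sy; rewrite !inE => /orP[/eqP E|//].
    by case: fC2; left.
  + exists (g k); rewrite y2 ?leqnn // mulr0 addr0.
    exact: cyc_binomial_neq0 uv duv uC vC k.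
- split.
    apply/setP => f; rewrite in_setI in_set1; apply/andP/eqP => [[]|->]; last first.
      by split; [apply/C1P | apply/C2P]; left.
    case/C1P=> [//|[i ik E]]; case/C2P=> [//|[j jk E']]; move: E.
    by rewrite E' => /(cyc_edge_eq P); rewrite !modn_small; lia.
  apply/eqP; rewrite eqEsubset; apply/andP; split; last first.
    apply/subsetP => w we; rewrite inE; apply/andP.
    by split; apply/bigcupP; exists e => //; [apply/C1P | apply/C2P]; left.
  apply/subsetP => w; rewrite inE => /andP[/(cyc_vertsP P1)[[i /= ik] wi]].
  case/(cyc_vertsP P2) => -[j /= jk] wj.
  rewrite !modn_small // in wi wj.
  move: (wi); rewrite wj => /(cyc_vert P) E; rewrite -wj wi eE !inE.
  (* Here i is at most k and k + j lies between k and n, so they agree modulo n only at the two ends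
     of the chord. *)
  have [jnk|jnk] := eqVneq (k + j)%N n.
    move: E; rewrite jnk modnn modn_small; last by lia.
    by move=> <-; rewrite eqxx.
  by move: E; rewrite !modn_small; [move=> E; rewrite (_ : i = k) ?eqxx ?orbT //; lia|lia|lia].
- apply/setP => f; rewrite in_setD1 in_setU.
  have [->|fe] := eqVneq f e; first by rewrite (negbTE eC).
  apply/CP/orP => [[i ilt E]|].
    have [ik|ik] := ltnP i k; [left; apply/C1P|right; apply/C2P]; right; exists i => //.
    by rewrite ik.
  case=> [/C1P|/C2P] [E|[i ik ->]]; try by rewrite E eqxx in fe.
    by exists i => //; lia.
  by exists i => //; lia.
Qed.
End OffCycleKernel.
End Chord.
End CycleKernel.
End Kernel.

(** * Supports of fiber elements, and the equivalence *)

Section FiberSupport.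
Import Order.TTheory GRing.Theory Num.Theory.
Local Open Scope ring_scope.

Lemma vdeg_gt0P (p m : nat) (D : wograph p m) (u : 'X_{1..m}) (y : 'I_p) :
  reflect (exists f, (0 < u f)%N && (y \in ends D f)) (0 < vdeg D u y)%N.
Proof.
rewrite vdegE; apply: (iffP idP) => [|[f /andP[uf yf]]]; last first.
  by rewrite (bigD1 f) //= ltn_addr // muln_gt0 uf inc_gt0.
move=> y0; apply/existsP; apply: contraTT y0 => /existsPn nof; rewrite -eqn0Ngt.
by apply/eqP/big1 => f _; apply/eqP; rewrite -leqn0 leqNgt muln_gt0 inc_gt0.
Qed.

(** Entries of A(D) are nonnegative, so nothing cancels: an end of f has positive degree in t, hence
    in u, and so meets an edge of [C]. *)
Lemma fiber_support (p m : nat) (D : wograph p m) (C : {set 'I_m})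
    (u t : 'X_{1..m}) (f : 'I_m) :
    (forall h, h \notin C -> u h = 0%N) -> vdeg D t = vdeg D u ->
  t f != 0%N -> ends D f \subset verts D C.
Proof.
move=> uC dtu; rewrite -lt0n => tf; apply/subsetP => y yf.
have : (0 < vdeg D t y)%N by apply/vdeg_gt0P; exists f; rewrite tf.
rewrite dtu => /vdeg_gt0P[h /andP[uh yh]]; apply/bigcupP; exists h => //.
by apply: contraLR uh => /uC ->.
Qed.

Lemma edge_subring_binomial (K : fieldType) (m : nat) (C : {set 'I_m})
    (u v : 'X_{1..m}) : u != v -> edge_subring C (binomial_of K u v) ->
  forall f, f \notin C -> u f = 0%N /\ v f = 0%N.
Proof.
move=> uv sub f fC; split; apply: (sub _ _ f fC).
  by rewrite mcoeff_msupp mcoeff_binomial eqxx [v == u]eq_sym (negbTE uv) subr0 oner_eq0.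
by rewrite mcoeff_msupp mcoeff_binomial eqxx (negbTE uv) sub0r oppr_eq0 oner_eq0.
Qed.

End FiberSupport.

Theorem theorem3p18 (K : fieldType) (p m : nat) (D : wograph p m)
    (C : {set 'I_m}) (e : 'I_m) (fc : {mpoly K[m]})
    (C_balanced : balanced_cycle D C)
    (e_chord : chord D C e)
    (e_unique : forall e' : 'I_m, chord D C e' -> e' = e)
    (fc_primitive : primitive (sub_toric_ideal D C) fc)
    (fc_generates : sub_toric_ideal_principal D C fc) :
  indispensable (toric_ideal D) fc <->
  ~ (exists C1 C2 : {set 'I_m},
       [/\ balanced_cycle D C1, balanced_cycle D C2,
           share_edge D C1 C2 e & C = (C1 :|: C2) :\ e]).
Proof.
have [C_cycle _] := C_balanced.
have [n [x [g [k [P eE k_gt1 k_lt]]]]] := chord_param C_cycle e_chord.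
have [eC _] := e_chord.
have [u [v [uv -> [fc_sub /toric_binomialP duv] prim]]] := fc_primitive.
have supp := edge_subring_binomial uv fc_sub.
have uC f : f \notin C -> u f = 0 by case/supp.
have vC f : f \notin C -> v f = 0 by case/supp.
split=> [indisp [C1 [C2 [balC1 _ [C12 _] CE]]]|no_pair].
  have eC1 : e \in C1 by have := set11 e; rewrite -C12 inE => /andP[].
  have /balanced_kernel[cycC1 [z [kz sz [f zf]]]] := balC1.
  have [n1 [x1 [g1 P1]]] := is_cycle_param cycC1.
  apply: (conn_not_indispensable (K := K)) indisp.
  apply: (off_cycle_kernel_conn P eE eC k_gt1 k_lt uv duv uC vC kz).
    by move=> h /sz hC1; rewrite CE !inE hC1 /= andbT orbN.
  (* A kernel vector on a cycle that vanishes at one of its edges is zero, so [z] is nonzero at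
     e. *)
  by apply: contra_neq zf => ze; exact: (cyc_kernel_eq0 P1 kz sz eC1 ze f).
(* Divisors of X^u and X^v involve only edges of [C], so primitivity in I_C extends to binomials of
   I_D. *)
have prim' u' v' : u' != v' -> vdeg D u' = vdeg D v' ->
    (u' <= u)%MM -> (v' <= v)%MM -> u' = u /\ v' = v.
  move=> uv' duv' leu lev; apply: prim => //; split; last exact/toric_binomialP.
  move=> w + f fC; rewrite mcoeff_msupp mcoeff_binomial.
  move=> w0; have [<-|wu] := eqVneq u' w.
    by apply/eqP; rewrite -leqn0 -(uC f fC); apply/mnm_lepP.
  have [<-|wv] := eqVneq v' w.
    by apply/eqP; rewrite -leqn0 -(vC f fC); apply/mnm_lepP.
  by move: w0; rewrite (negbTE wu) (negbTE wv) GRing.subrr eqxx.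
have fiber t : vdeg D t = vdeg D u -> (forall f, f \notin C -> t f = 0) ->
    (forall f, u f = 0 \/ v f = 0) /\ (t = u \/ t = v).
  exact: (primitive_fiber P uv duv uC vC prim').
apply: unique_fiber_indispensable => //; first by case: (fiber u).
move=> t dtu; apply: (proj2 (fiber t dtu _)) => f fC; apply/eqP.
apply: contraT => tf; case: no_pair.
(* An edge off [C] used by [t] has both ends on [C], so it is the only chord. *)
have fe : f = e by apply: e_unique; split=> //; apply: fiber_support uC dtu tf.
have e_only h : h \notin C -> t h != 0 -> h = e.
  by move=> hC th; apply: e_unique; split=> //; apply: fiber_support uC dtu th.
pose z h : rat := ((t h)%:R - (u h)%:R)%R.
apply: (off_cycle_kernel_balanced P eE eC k_gt1 k_lt uv duv uC vC (z := z)).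
- exact/vdeg_kernel.
- move=> h; rewrite !inE; have [//|hC zh] := boolP (h \in C); first by rewrite orbT.
  rewrite orbF; apply/eqP/e_only => //; apply: contra_neq zh => th.
  by rewrite /z th uC // GRing.subrr.
- by rewrite -fe /z uC // GRing.subr0 Num.Theory.pnatr_eq0.
Qed.
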